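(* Let $0<a<b$, $p,q>1$ with $\frac1p+\frac1q=1$, and $s\in(0,1)$, and let $M>0$ be such that $s(1-s)t^{s-2}\le M$ for all $t\in[a,b]$. Write $A=A(a,b)$. Then for all $x\in[a,b]$ $$\left|L_s^s(a,b)-x^s+s(x-A)x^{s-1}\right|\le\frac{3M}{(2p+1)^{1/p}}\left(\frac{2}{s+1}\right)^{\frac1q}\left[\frac{1}{24}(b-a)^2+\frac12(x-A)^2\right].$$ In particular, taking $x=A$, $$\left|L_s^s(a,b)-A^s\right|\le\frac{M}{8(2p+1)^{1/p}}\left(\frac{2}{s+1}\right)^{\frac1q}(b-a)^2.$$
   Context: For $a,b>0$ with $a\neq b$: the arithmetic mean is $A(a,b)=\frac{a+b}{2}$; the generalized log-mean is $L_r(a,b)=\left[\frac{b^{r+1}-a^{r+1}}{(r+1)(b-a)}\right]^{1/r}$ for $r\in\mathbb{R}\setminus\{-1,0\}$; and $L_s^s(a,b)=(L_s(a,b))^s$. *)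

(* Defs.v *)
From mathcomp Require Import all_boot all_order all_algebra.
From mathcomp Require Import reals exp.

Set Implicit Arguments.
Unset Strict Implicit.
Unset Printing Implicit Defensive.

Import Order.TTheory GRing.Theory Num.Theory.
Local Open Scope ring_scope.

Definition arith_mean (R : realType) (a b : R) : R := (a + b) / 2.

(* Meaningful for a, b > 0, a != b and r \notin {-1, 0}; outside this range
   the value is a by-product of the conventions of powR and of division. *)
Definition gen_log_mean (R : realType) (r a b : R) : R :=
  ((b `^ (r + 1) - a `^ (r + 1)) / ((r + 1) * (b - a))) `^ (1 / r).

(* Main.v *)
Require Import Defs.
From mathcomp Require Import all_boot all_order all_algebra.
From mathcomp Require Import reals exp.
From mathcomp Require Import functions normedtype derive.
From mathcomp Require Import ring lra.

Set Implicit Arguments.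
Unset Strict Implicit.
Unset Printing Implicit Defensive.

Import Order.TTheory GRing.Theory Num.Theory.
Import numFieldNormedType.Exports.
Local Open Scope ring_scope.

(** With [f t = t ^ s], the quantity [L_s ^ s] is the mean of [f] over [a, b],
    and [A - x] is the mean of [t - x]; so the left-hand side is the mean of the
    first-order Taylor remainder of [f] at [x], which is at most
    [M / 2 * (t - x) ^ 2] in absolute value. Averaging gives the bound with
    constant [M]. The remaining factor [3 / (2 p + 1) ^ (1/p) * (2 / (s + 1)) ^ (1/q)]
    is at least [1], because [1 + 2 p <= 3 ^ p] by Bernoulli's inequality. *)

Lemma is_derive_MVT (R : realType) (f df : R -> R) (a b : R) :
  (forall t, a <= t <= b -> is_derive t 1 f (df t)) -> a <= b ->
  exists2 c, a <= c <= b & f b - f a = df c * (b - a).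
Proof.
move=> fdf leab.
have [||c + fE] := @MVT_segment R f df a b leab.
- by move=> t /subset_itv_oo_cc; rewrite in_itv/= => /fdf.
- by apply: derivable_within_continuous => t; rewrite in_itv/= => /fdf [].
by rewrite in_itv/=; exists c.
Qed.

Lemma is_derive_nneg_le (R : realType) (f df : R -> R) (a b : R) :
  (forall t, a <= t <= b -> is_derive t 1 f (df t)) ->
  (forall t, a <= t <= b -> 0 <= df t) -> a <= b -> f a <= f b.
Proof.
move=> fdf df_ge0 leab; have [c cab fE] := is_derive_MVT fdf leab.
by rewrite -subr_ge0 fE mulr_ge0 ?subr_ge0// df_ge0.
Qed.

Section SecondDerivativeBounds.
Variables (R : realType) (f g h : R -> R) (a b : R).
Hypothesis fg : forall t, a <= t <= b -> is_derive t 1 f (g t).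
Hypothesis gh : forall t, a <= t <= b -> is_derive t 1 g (h t).

(** The mean value theorem turns [f t - f x] into [g c * (t - x)] with [c] between [x] and [t]. As
    [h >= 0] makes [g] nondecreasing, [g c - g x] has the sign of [t - x], on either side of [x]. *)
Lemma tangent_le (x t : R) : (forall u, a <= u <= b -> 0 <= h u) ->
  a <= x <= b -> a <= t <= b -> f x + g x * (t - x) <= f t.
Proof.
move=> h_ge0.
have g_mono u v : a <= u -> u <= v -> v <= b -> g u <= g v.
  move=> au uv vb; apply: (@is_derive_nneg_le _ g h) => // w /andP[uw wv].
  - by apply: gh; rewrite (le_trans au uw) (le_trans wv vb).
  - by apply: h_ge0; rewrite (le_trans au uw) (le_trans wv vb).
have key u v : a <= u -> u <= v -> v <= b ->
    exists2 c, u <= c <= v & f v - f u = g c * (v - u).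
  move=> au uv vb; apply: is_derive_MVT => // w /andP[uw wv].
  by apply: fg; rewrite (le_trans au uw) (le_trans wv vb).
move=> /andP[ax xb] /andP[at_ tb].
have [xt|/ltW tx] := leP x t.
- have [c /andP[xc ct] fE] := key _ _ ax xt tb.
  have gc := g_mono _ _ ax xc (le_trans ct tb).
  by nra.
- have [c /andP[tc cx] fE] := key _ _ at_ tx xb.
  have gc := g_mono _ _ (le_trans at_ tc) cx xb.
  by nra.
Qed.

Variable F : R -> R.
Hypothesis Ff : forall t, a <= t <= b -> is_derive t 1 F (f t).

Lemma tangent_mean_le (x : R) : (forall u, a <= u <= b -> 0 <= h u) ->
  a <= x <= b -> (f x + g x * ((a + b) / 2 - x)) * (b - a) <= F b - F a.
Proof.
move=> h_ge0 xab.
(* [K] is an antiderivative of the gap between [f] and its tangent at [x]. That gap is nonnegative,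
   so [K] increases: the tangent inequality is averaged without any integral. *)
pose K := F - (f x) *: id - (g x / 2) *: (id - cst x) ^+ 2.
have : K a <= K b.
  apply: (@is_derive_nneg_le _ K (fun t => f t - f x - g x * (t - x))).
  - move=> t /Ff Ft; apply: is_derive_eq.
    by rewrite /GRing.scale/= !fctE/=; field.
  - by move=> t /(tangent_le h_ge0 xab); lra.
  - by case/andP: xab => /le_trans; apply.
rewrite /K !fctE /GRing.scale/=; lra.
Qed.

End SecondDerivativeBounds.

(** The bracket on the right is half the mean of [(t - x) ^+ 2] over [a, b]: the variance
    [(b - a) ^+ 2 / 12] plus the squared distance from [x] to the midpoint, both halved. *)
Lemma taylor1_mean_error (R : realType) (F f g h : R -> R) (a b M x : R) :
  (forall t, a <= t <= b -> is_derive t 1 F (f t)) ->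
  (forall t, a <= t <= b -> is_derive t 1 f (g t)) ->
  (forall t, a <= t <= b -> is_derive t 1 g (h t)) ->
  (forall t, a <= t <= b -> `|h t| <= M) -> a < b -> a <= x <= b ->
  `|(F b - F a) / (b - a) - f x + (x - (a + b) / 2) * g x|
    <= M * (1 / 24 * (b - a) ^+ 2 + 1 / 2 * (x - (a + b) / 2) ^+ 2).
Proof.
move=> Ff fg gh hM ltab xab.
have ba_gt0 : 0 < b - a by rewrite subr_gt0.
(* The sign [e], equal to 1 or -1, treats both halves of the absolute value at once; the bound on
   [h] makes the second derivative [M - e * h t] nonnegative in either case. *)
have shifted (e : R) : e ^+ 2 = 1 ->
    e * ((F b - F a) - (f x - (x - (a + b) / 2) * g x) * (b - a)) <=
      M * (1 / 24 * (b - a) ^+ 2 + 1 / 2 * (x - (a + b) / 2) ^+ 2) * (b - a).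
  move=> e2.
  (* [- e f + M t ^ 2 / 2] is convex, so it lies above its tangents. *)
  have := @tangent_mean_le R (- e *: f + (M / 2) *: id ^+ 2)
    (- e *: g + M *: id) (- e *: h + cst M) a b _ _
    (- e *: F + (M / 6) *: id ^+ 3) _ x _ xab.
  have H1 t : a <= t <= b ->
      is_derive t 1 (- e *: f + (M / 2) *: id ^+ 2) ((- e *: g + M *: id) t).
    move=> /fg ft; apply: is_derive_eq.
    by rewrite !fctE /GRing.scale/=; field.
  have H2 t : a <= t <= b ->
      is_derive t 1 (- e *: g + M *: id) ((- e *: h + cst M) t).
    move=> /gh gt; apply: is_derive_eq.
    by rewrite !fctE /GRing.scale/=; field.
  have H3 t : a <= t <= b -> is_derive t 1 (- e *: F + (M / 6) *: id ^+ 3)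
      ((- e *: f + (M / 2) *: id ^+ 2) t).
    move=> /Ff Ft; apply: is_derive_eq.
    by rewrite !fctE /GRing.scale/=; field.
  have H4 t : a <= t <= b -> 0 <= (- e *: h + cst M) t.
    move=> /hM; rewrite ler_norml !fctE /GRing.scale/= => /andP[h1 h2].
    have /eqP := e2; rewrite -[1](expr1n _ 2) eqf_sqr => /orP[] /eqP ->; lra.
  move=> /(_ H1 H2 H3 H4); rewrite !fctE /GRing.scale/=.
  by lra.
have := shifted 1 (expr1n _ _); have := shifted (-1) (etrans (sqrrN 1) (expr1n _ _)).
set B := M * _; set N := (F b - F a) - _ => lower upper.
have -> : (F b - F a) / (b - a) - f x + (x - (a + b) / 2) * g x = N / (b - a).
  by rewrite /N; field; rewrite gt_eqF.
by rewrite normrM normfV (gtr0_norm ba_gt0) ler_pdivrMr// ler_norml; lra.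
Qed.

Lemma bernoulli_powR (R : realType) (y p : R) :
  1 <= y -> 1 <= p -> 1 + p * (y - 1) <= y `^ p.
Proof.
move=> y_ge1 p_ge1.
have pos t : 1 <= t <= y -> 0 < t by case/andP=> t1 _; lra.
have := @tangent_le R (@powR R ^~ p) (p *: (@powR R ^~ (p - 1)))
  (fun t => p * ((p - 1) * t `^ (p - 1 - 1))) 1 y _ _ 1 y.
rewrite powR1 !fctE /GRing.scale/= powR1 mulr1; apply => //.
- by move=> t /pos t_gt0; exact: is_derive1_powR.
- move=> t /pos t_gt0.
  have d := is_derive1_powR (p - 1) t_gt0.
  exact: is_deriveZ.
- by move=> t _; rewrite !mulr_ge0 ?powR_ge0//; lra.
- by rewrite lexx.
- by rewrite lexx andbT.
Qed.

(** Both factors are at least 1: the first by Bernoulli at [y = 3] followed by a [p]-th root, the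
    second because [s < 1] gives [2 / (s + 1) >= 1]. *)
Lemma hoelder_factor_ge1 (R : realType) (p q s : R) :
  1 < p -> 1 < q -> 0 < s -> s < 1 ->
  1 <= 3 / (2 * p + 1) `^ (1 / p) * (2 / (s + 1)) `^ (1 / q).
Proof.
move=> p_gt1 q_gt1 s_gt0 s_lt1.
have p_gt0 : 0 < p by lra.
have root_le3 : (2 * p + 1) `^ (1 / p) <= 3.
  have := @bernoulli_powR R 3 p; rewrite ler1n (ltW p_gt1) => /(_ isT isT) bern.
  have -> : 3 = (3 `^ p) `^ (1 / p) :> R.
    by rewrite -powRrM mul1r divff ?gt_eqF// powRr1.
  by rewrite ge0_ler_powR ?nnegrE ?powR_ge0 ?divr_ge0//; lra.
have s_ge1 : 1 <= (2 / (s + 1)) `^ (1 / q).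
  rewrite -[leLHS](powRr0 (2 / (s + 1))) ler_powR ?divr_ge0//; last by lra.
  by rewrite ler_pdivlMr; lra.
rewrite -[leLHS]mulr1 ler_pM//.
have root_gt0 : 0 < (2 * p + 1) `^ (1 / p) by apply: powR_gt0; lra.
by rewrite ler_pdivlMr// [leLHS]mul1r.
Qed.

Lemma gen_log_mean_powR (R : realType) (r a b : R) :
  0 < a -> a < b -> 0 < r ->
  gen_log_mean r a b `^ r
    = (b `^ (r + 1) / (r + 1) - a `^ (r + 1) / (r + 1)) / (b - a).
Proof.
move=> a_gt0 ltab r_gt0; rewrite /gen_log_mean -powRrM.
rewrite divfK ?gt_eqF// powRr1.
  by field; rewrite !gt_eqF ?subr_gt0//; lra.
rewrite divr_ge0// ?subr_ge0.
  by rewrite ge0_ler_powR ?nnegrE ?(ltW ltab)//; lra.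
by rewrite mulr_ge0; lra.
Qed.

Theorem proposition2 (R : realType) (a b p q s M : R)
  (a_gt0 : 0 < a) (ltab : a < b)
  (p_gt1 : 1 < p) (q_gt1 : 1 < q) (pq_conj : 1 / p + 1 / q = 1)
  (s_gt0 : 0 < s) (s_lt1 : s < 1) (M_gt0 : 0 < M)
  (boundM : forall t : R, a <= t <= b -> s * (1 - s) * t `^ (s - 2) <= M) :
  (forall x : R, a <= x <= b ->
     `| gen_log_mean s a b `^ s - x `^ s
        + s * (x - arith_mean a b) * x `^ (s - 1) |
     <= 3 * M / (2 * p + 1) `^ (1 / p) * (2 / (s + 1)) `^ (1 / q)
        * (1 / 24 * (b - a) ^+ 2 + 1 / 2 * (x - arith_mean a b) ^+ 2))
  /\
  `| gen_log_mean s a b `^ s - arith_mean a b `^ s |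
  <= M / (8 * (2 * p + 1) `^ (1 / p)) * (2 / (s + 1)) `^ (1 / q)
     * (b - a) ^+ 2.
Proof.
have main (x : R) : a <= x <= b ->
     `| gen_log_mean s a b `^ s - x `^ s
        + s * (x - arith_mean a b) * x `^ (s - 1) |
     <= 3 * M / (2 * p + 1) `^ (1 / p) * (2 / (s + 1)) `^ (1 / q)
        * (1 / 24 * (b - a) ^+ 2 + 1 / 2 * (x - arith_mean a b) ^+ 2).
  move=> xab; rewrite gen_log_mean_powR// /arith_mean.
  have pos t : a <= t <= b -> 0 < t by case/andP=> at_ _; lra.
  have := @taylor1_mean_error R ((s + 1)^-1 *: @powR R ^~ (s + 1)) (@powR R ^~ s)
    (s *: @powR R ^~ (s - 1)) (fun t => s * ((s - 1) * t `^ (s - 1 - 1))) a b M x.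
  rewrite !fctE /GRing.scale/= => err.
  set B := 1 / 24 * _ + _.
  have B_ge0 : 0 <= B by rewrite addr_ge0// mulr_ge0 ?sqr_ge0//; lra.
  have -> : 3 * M / (2 * p + 1) `^ (1 / p) * (2 / (s + 1)) `^ (1 / q) * B =
      (3 / (2 * p + 1) `^ (1 / p) * (2 / (s + 1)) `^ (1 / q)) * (M * B) by ring.
  apply: (@le_trans _ _ (M * B)); last first.
    by rewrite ler_peMl ?hoelder_factor_ge1// mulr_ge0// ltW.
  rewrite -!(mulrC (s + 1)^-1) -mulrA (mulrCA s); apply: err => // t /[dup] tab /pos t_gt0.
  - have d := is_derive1_powR (s + 1) t_gt0.
    apply: is_derive_eq; rewrite /GRing.scale/= addrK mulKf// gt_eqF//; lra.
  - exact: is_derive1_powR.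
  - have d := is_derive1_powR (s - 1) t_gt0.
    exact: is_deriveZ.
  - have -> : s - 1 - 1 = s - 2 by ring.
    (* Since [0 < s < 1], the coefficient [s * (s - 1)] is nonpositive, and its absolute value is
       the [s * (1 - s)] of [boundM]. *)
    rewrite mulrA normrM (ger0_norm (powR_ge0 _ _)) ler0_norm; last by nra.
    by rewrite -mulrN opprB boundM.
split=> //.
have Aab : a <= arith_mean a b <= b by rewrite /arith_mean; lra.
have := main _ Aab; rewrite subrr mulr0 mul0r addr0 expr0n/= mulr0 addr0.
(* With [x] at the mean only the first term of the bracket survives, and the two bounds are equal
   since [3 / 24 = 1 / 8]. *)
move/le_trans; apply; rewrite le_eqVlt; apply/predU1P; left.
have : (2 * p + 1) `^ (1 / p) != 0 by rewrite gt_eqF// powR_gt0//; lra.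
by move=> ?; field.
Qed.
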